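(* Let $(\Omega,\mathcal{B},P)$ be a probability space and let $\mathcal{A}=\bigcap_{n\geq 1}\mathcal{A}_n$, where $\mathcal{B}\supset\mathcal{A}_1\supset\mathcal{A}_2\supset\cdots$ and $\mathcal{A}_n$ is a countably generated $\sigma$-field for each $n$. Given a regular conditional distribution $\mu$ for $P$ given $\mathcal{A}$, there is a set $A_0\in\mathcal{A}$ such that $P(A_0)=1$ and $\mu(\omega)(A)\in\{0,1\}$ for all $A\in\mathcal{A}$ and $\omega\in A_0$.
   Context: Let $\mathbb{P}$ be the set of probability measures on $\mathcal{B}$. A regular conditional distribution for $P$ given $\mathcal{A}$ is a map $\mu:\Omega\to\mathbb{P}$ such that, for all $B\in\mathcal{B}$, the function $\omega\mapsto\mu(\omega)(B)$ is a version of $E(I_B\mid\mathcal{A})$ (in particular it is $\mathcal{A}$-measurable). A $\sigma$-field is countably generated if it is generated by one of its countable subclasses. The $\sigma$-field $\mathcal{B}$ is not assumed to be countably generated here. *)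

(* Defs.v *)
From mathcomp Require Import all_boot all_order all_algebra.
From mathcomp Require Import all_classical all_reals all_analysis.
From mathcomp Require Import measurable_realfun.

Set Implicit Arguments.
Unset Strict Implicit.
Unset Printing Implicit Defensive.

Import Order.TTheory GRing.Theory Num.Theory.

Local Open Scope classical_set_scope.
Local Open Scope ring_scope.
Local Open Scope ereal_scope.

(* Sub-sigma-fields are classes of sets over the fixed ambient type [T], rather
   than further [measurableType] structures on [T]; the ambient sigma-field is
   [measurable : set (set T)]. *)
Definition sub_sigma_field (d : measure_display) (T : measurableType d)
    (G : set (set T)) : Prop :=
  sigma_algebra setT G /\ G `<=` measurable.

Definition countably_generated (T : Type) (G : set (set T)) : Prop :=
  exists C : set (set T), [/\ countable C, C `<=` G & <<s C >> = G].

(* [g_sigma_algebraType G] is [T] equipped with the sigma-field <<s G >>, which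
   is [G] itself when [G] is a sigma-field. *)
Definition measurable_wrt (d : measure_display) (T : measurableType d)
    (G : set (set T)) (R : realType) (Y : T -> \bar R) : Prop :=
  measurable_fun [set: g_sigma_algebraType G]
    (Y : g_sigma_algebraType G -> \bar R).

(* [Y] is a version of E(X | G), for a sub-sigma-field [G] and an integrable
   [X]. *)
Definition is_cond_exp (d : measure_display) (T : measurableType d)
    (R : realType) (P : probability T R) (G : set (set T))
    (X Y : T -> \bar R) : Prop :=
  [/\ measurable_wrt G Y,
      P.-integrable setT Y &
      forall A, G A -> \int[P]_(w in A) Y w = \int[P]_(w in A) X w].

Definition regular_cond_distr (d : measure_display) (T : measurableType d)
    (R : realType) (P : probability T R) (G : set (set T))
    (mu : T -> probability T R) : Prop :=
  forall B, measurable B ->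
    is_cond_exp P G (fun w => (\1_B w)%:E) (fun w => mu w B).

(* Main.v *)
(* Let B be measurable and f_n a version of P(B | A_n). Since A_n is countably
   generated, for P-almost every w the function f_n is also a version of the
   conditional probability of B given A_n under mu(w): it suffices to check the
   defining identity on a countable pi-system generating A_n, and there it is
   the uniqueness of conditional expectations given A. By backward L^2
   convergence, the integral of f_n^2 under P decreases to that of
   E(1_B | A)^2 = mu(.)(B)^2, so for P-almost every w the variance of f_n under
   mu(w) has infimum 0 over n. As the mean of f_n under mu(w) is mu(w)(B), for
   such w the event B is independent under mu(w) of every E in A, E being in
   each A_n. Letting B range over a countable pi-system generating A_1, for
   P-almost every w the class A is independent of A_1, hence of itself, under
   mu(w). *)

Require Import Defs.
From HB Require Import structures.
From mathcomp Require Import all_boot all_order all_algebra.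
From mathcomp Require Import all_classical all_reals all_analysis.
From mathcomp Require Import measurable_realfun giry.
From mathcomp Require Import ring lra zify.

Set Implicit Arguments.
Unset Strict Implicit.
Unset Printing Implicit Defensive.

Import Order.TTheory GRing.Theory Num.Theory.

Local Open Scope classical_set_scope.
Local Open Scope ring_scope.
Local Open Scope ereal_scope.

Lemma probability1P d (T : measurableType d) (R : realType)
    (P : probability T R) (S : set T) : measurable S ->
  P S = 1 <-> {ae P, forall w, S w}.
Proof.
move=> mS; have mCS := measurableC mS.
have PC : P (~` S) = 1 - P S by exact: probability_setC.
split=> [PS|/(negligibleP P mCS)/eqP].
  by apply/(negligibleP P mCS); transitivity (1 - P S) => //; rewrite PS subee.
change (P (~` S) == 0 -> P S = 1); rewrite PC sube_eq ?fin_num_measure//.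
by rewrite add0e => /eqP.
Qed.

(** * Sub-sigma-fields *)

Section sub_sigma_field_theory.
Context d (T : measurableType d) (R : realType) (G : set (set T)).
Hypothesis hG : sub_sigma_field G.

Lemma sub_sigma_fieldE : <<s G >> = G.
Proof. exact: sigma_algebra_id hG.1. Qed.

Lemma sub_sigma_fieldT : G setT.
Proof.
by rewrite -sub_sigma_fieldE; exact: (@measurableT _ (g_sigma_algebraType G)).
Qed.

Lemma measurable_to_sub_sigma_field :
  measurable_fun setT (idfun : T -> g_sigma_algebraType G).
Proof.
move=> _ B; rewrite /measurable/= sub_sigma_fieldE => GB.
by rewrite setTI; exact: hG.2.
Qed.

Lemma measurable_wrt_measurable (Y : T -> \bar R) :
  measurable_wrt G Y -> measurable_fun setT Y.
Proof.
move=> mY; exact: (measurableT_comp mY measurable_to_sub_sigma_field).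
Qed.

Lemma measurable_wrt_preimage (Y : T -> \bar R) B :
  measurable_wrt G Y -> measurable B -> G (Y @^-1` B).
Proof.
by move=> mY mB; rewrite -sub_sigma_fieldE -[_ @^-1` _]setTI; exact: mY.
Qed.

Lemma measurable_wrt_sub (G' : set (set T)) (Y : T -> \bar R) :
   G' `<=` G -> measurable_wrt G' Y -> measurable_wrt G Y.
Proof.
move=> sG mY _ B mB; have := mY measurableT B mB.
exact: (sub_sigma_algebra2 sG).
Qed.

Lemma sub_sigma_field_eqset (Y Z : T -> \bar R) :
  measurable_wrt G Y -> measurable_wrt G Z -> G [set w | Y w = Z w].
Proof.
move=> mY mZ; rewrite -sub_sigma_fieldE -[X in <<s G >> X]setTI.
exact: (@measurable_eqe _ (g_sigma_algebraType G) R _ measurableT Y Z mY mZ).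
Qed.

(** Restriction to [G] is encoded as the image of [Q] under the identity map into the coarser space,
    so that change of variables along a measurable map compares integrals on the two spaces. *)
Definition restr_sub_sigma_field (Q : giry T R) :
    giry (g_sigma_algebraType G) R :=
  giry_map measurable_to_sub_sigma_field Q.

Lemma integral_restr_sub_sigma_field (Q : giry T R) D (h : T -> \bar R) :
  G D -> measurable_wrt G h -> (forall x, 0 <= h x) ->
  \int[restr_sub_sigma_field Q]_(w in D) h w = \int[Q]_(w in D) h w.
Proof.
move=> GD mh h0.
have mD : measurable (D : set (g_sigma_algebraType G)).
  by rewrite /measurable/= sub_sigma_fieldE.
have := @ge0_integral_pushforward _ _ _ _ R _ measurable_to_sub_sigma_field Q D
   h mD (measurable_funTS mh).
by apply => y _; exact: h0.
Qed.

(** Equal integrals over all measurable sets force a.e. equality; this principle is applied on the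
    space whose measurable sets are exactly those of [G], and the null set found there is then null
    for [P]. *)
Lemma cond_exp_unique (P : probability T R) (Y Z : T -> \bar R) :
  measurable_wrt G Y -> measurable_wrt G Z ->
  (forall w, 0 <= Y w) -> (forall w, 0 <= Z w) ->
  \int[P]_w Y w < +oo ->
  (forall D, G D -> \int[P]_(w in D) Y w = \int[P]_(w in D) Z w) ->
  P [set w | Y w = Z w] = 1.
Proof.
move=> mY mZ Y0 Z0 Yoo YZ.
have GYZ := sub_sigma_field_eqset mY mZ.
pose Q := restr_sub_sigma_field P.
have [|||/=] :=
  @integral_ae_eq _ (g_sigma_algebraType G) R Q setT measurableT Z Y.
- apply/integrableP; split; first exact: mY.
  under eq_integral do rewrite gee0_abs//.
  by rewrite integral_restr_sub_sigma_field//; exact: sub_sigma_fieldT.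
- exact: mZ.
- move=> E _; rewrite /measurable/= sub_sigma_fieldE => GE.
  by rewrite !integral_restr_sub_sigma_field// YZ.
move=> N [mN QN YZN]; apply/(probability1P _ (hG.2 _ GYZ)).
exists N; split; [|exact: QN|by move=> w /= YZw; apply: YZN => /= /(_ Logic.I)].
by apply: hG.2; rewrite -sub_sigma_fieldE.
Qed.

End sub_sigma_field_theory.

Section subprob_restr.
Context d (T : measurableType d) (R : realType) (P : probability T R).
Variables (E : set T) (mE : measurable E).

Let restr := mrestr P mE.

Let restr_le1 : restr setT <= 1.
Proof. by rewrite /restr/mrestr setTI probability_le1. Qed.

HB.instance Definition _ := Measure.on restr.
HB.instance Definition _ :=
  Measure_isSubProbability.Build _ _ _ restr restr_le1.

(** The measure P(. ∩ E) is left unnormalized, so that it is an element of [giry T R] even when [E]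
    is a null set. *)
Definition subprob_restr : giry T R := restr.

Lemma integral_subprob_restr (k : T -> \bar R) :
  measurable_fun setT k -> (forall x, 0 <= k x) ->
  \int[subprob_restr]_w k w = \int[P]_(w in E) k w.
Proof.
move=> mk k0.
rewrite (@ge0_negligible_integral _ _ _ _ _ (~` E))//; last 2 first.
- exact: measurableC.
- by rewrite /subprob_restr/= /restr/mrestr setICl measure0.
rewrite setTD setCK; apply: eq_measure_integral => B mB BE.
by rewrite /subprob_restr/= /restr/mrestr setIidl.
Qed.

End subprob_restr.

(** * Integration against a regular conditional distribution *)

Section disintegration.
Context d (T : measurableType d) (R : realType) (G : set (set T))
  (P : probability T R) (mu : T -> probability T R).
Hypotheses (hG : sub_sigma_field G) (hmu : regular_cond_distr P G mu).

Lemma measurable_wrt_integral_rcd (h : T -> \bar R) :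
  measurable_fun setT h -> (forall x, 0 <= h x) ->
  measurable_wrt G (fun w => \int[mu w]_x h x).
Proof.
move=> mh h0.
apply: (@measurable_fun_integral_kernel _ _ (g_sigma_algebraType G)) => // U mU.
by have [] := hmu mU.
Qed.

(** Mixing the measures [mu w] with respect to P(. ∩ E) restricted to [G] gives back P(. ∩ E): on an
    event this is the defining identity of [mu]. The bind of the Giry monad carries the identity
    from events to nonnegative functions. *)
Lemma disintegration (h : T -> \bar R) E :
  measurable_fun setT h -> (forall x, 0 <= h x) -> G E ->
  \int[P]_(w in E) \int[mu w]_x h x = \int[P]_(w in E) h w.
Proof.
move=> mh h0 GE; have mE := hG.2 _ GE.
have mmu : measurable_fun [set: g_sigma_algebraType G] (mu : _ -> giry T R).
  by apply: measurable_giry_codensity => // B mB; have [] := hmu mB.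
have := giry_int_bind (restr_sub_sigma_field hG (subprob_restr P mE)) mmu mh h0.
rewrite /giry_int integral_restr_sub_sigma_field//; last 3 first.
- exact: (sub_sigma_fieldT hG).
- exact: measurable_wrt_integral_rcd.
- by move=> w; exact: integral_ge0.
rewrite integral_subprob_restr; last 2 first.
- apply: (measurable_wrt_measurable hG); exact: measurable_wrt_integral_rcd.
- by move=> w; exact: integral_ge0.
move=> <-; rewrite -integral_subprob_restr//.
apply: eq_measure_integral => B mB _.
transitivity (\int[restr_sub_sigma_field hG (subprob_restr P mE)]_w mu w B).
  exact: (giry_int_map mmu (restr_sub_sigma_field hG (subprob_restr P mE))
    (measurable_giry_ev mB)).
have [mB' _ intB] := hmu mB.
rewrite integral_restr_sub_sigma_field//; last exact: (sub_sigma_fieldT hG).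
rewrite integral_subprob_restr//; last exact: (measurable_wrt_measurable hG).
by rewrite intB// integral_indic.
Qed.

End disintegration.

(** * Versions of a conditional probability *)

(** Values are real and lie in [0, 1] at every point, not just almost everywhere: [f] will be
    integrated under the measures [mu w], where a bound valid [P]-a.e. would not apply directly. *)
Definition cond_prob_version d (T : measurableType d) (R : realType)
    (P : probability T R) (G : set (set T)) (B : set T) (f : T -> R) : Prop :=
  [/\ measurable_wrt G (EFin \o f), (forall w, (0 <= f w <= 1)%R) &
      forall D, G D -> \int[P]_(w in D) (f w)%:E = P (D `&` B)].

Section cond_prob_version.
Context d (T : measurableType d) (R : realType) (G : set (set T))
  (P : probability T R).
Hypothesis hG : sub_sigma_field G.

Let S := g_sigma_algebraType G.
Let PG := restr_sub_sigma_field hG P.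
Let nu B (mB : measurable B) := restr_sub_sigma_field hG (subprob_restr P mB).

Let nuE B (mB : measurable B) D : nu mB D = P (D `&` B).
Proof. by []. Qed.

Let dom B (mB : measurable B) : nu mB `<< PG.
Proof.
apply/null_content_dominatesP => D mD.
move: mD; rewrite /measurable/= (sub_sigma_fieldE hG) => GD PD0.
apply: (@subset_measure0 _ _ _ P _ D) => //.
- exact: measurableI (hG.2 _ GD) mB.
- exact: hG.2.
Qed.

(** The density on [G] of P(. ∩ B) with respect to [P]: conditional probability up to the pointwise
    bound by 1. *)
Let h B (mB : measurable B) : S -> \bar R :=
  Radon_Nikodym_SigmaFinite.f (nu mB) PG.

Lemma cond_prob_version_exists B : measurable B ->
  exists f, cond_prob_version P G B f.
Proof.
move=> mB; have mCB := measurableC mB.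
have h0 := Radon_Nikodym_SigmaFinite.f_ge0 (dom mB).
have hfin := Radon_Nikodym_SigmaFinite.f_fin_num (dom mB).
have hint := Radon_Nikodym_SigmaFinite.f_integrable (dom mB).
have hE := Radon_Nikodym_SigmaFinite.f_integral (dom mB).
have h'0 := Radon_Nikodym_SigmaFinite.f_ge0 (dom mCB).
have h'int := Radon_Nikodym_SigmaFinite.f_integrable (dom mCB).
have h'E := Radon_Nikodym_SigmaFinite.f_integral (dom mCB).
pose f w := Num.min (fine (h mB w)) 1%R.
have fE : EFin \o f = (fun w => mine (h mB w) 1).
  by apply/funext => w; rewrite /f/= EFin_min fineK//; exact: hfin.
have mf : measurable_wrt G (EFin \o f).
  rewrite /measurable_wrt fE; apply: measurable_mine => //.
  exact: measurable_int hint.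
have f01 w : (0 <= f w <= 1)%R.
  by rewrite /f ge_min lexx orbT andbT le_min ler01 andbT fine_ge0//; exact: h0.
exists f; split => // D GD.
have mD : measurable (D : set S) by rewrite /measurable/= (sub_sigma_fieldE hG).
rewrite -(integral_restr_sub_sigma_field hG)//; last first.
  by move=> x; rewrite lee_fin; case/andP: (f01 x).
rewrite -(nuE mB) hE//; apply: ge0_ae_eq_integral => //.
- exact: measurable_funTS.
- by apply: measurable_funS (measurable_int _ hint).
- by move=> x _; rewrite lee_fin; case/andP: (f01 x).
(* The densities of [B] and of its complement add up to 1, so truncating the
   former at 1 changes it only on a null set. *)
have : ae_eq PG setT (h mB \+ h mCB) (cst 1).
  apply: integral_ae_eq => //; first exact: integrableD.
  move=> E _ mE; rewrite ge0_integralD//; last 4 first.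
  - by move=> x _; exact: h0.
  - by apply: measurable_funS (measurable_int _ hint).
  - by move=> x _; exact: h'0.
  - by apply: measurable_funS (measurable_int _ h'int).
  rewrite -hE// -h'E// integral_cst// mul1e.
  transitivity (P (E `&` B) + P (E `&` ~` B)); first by [].
  have mE' : measurable (E : set T).
    by apply: hG.2; rewrite -(sub_sigma_fieldE hG).
  rewrite -measureU//.
  - by rewrite -setIUr setUv setIT.
  - exact: measurableI.
  - exact: measurableI.
  - by rewrite setIACA setICr setI0.
move=> ae1; apply: (@ae_eq_subset _ _ _ _ _ setT) => //.
apply: filterS ae1 => w /= /(_ Logic.I) hh' _.
have -> : (f w)%:E = (EFin \o f) w by [].
rewrite fE; apply/min_idPl; rewrite -hh'; apply: leeDl; exact: h'0.
Qed.

(** Both sides are the integral of [u] against P(. ∩ B) restricted to [G], since [f] agrees a.e.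
    with the Radon-Nikodym density of that measure. *)
Lemma integral_mule_cond_prob B f (u : T -> \bar R) : measurable B ->
  cond_prob_version P G B f ->
  measurable_wrt G u -> (forall w, 0 <= u w) ->
  \int[P]_w (u w * (f w)%:E) = \int[P]_(w in B) u w.
Proof.
move=> mB [mf f01 fE] mu u0.
have f0 w : 0 <= (f w)%:E by rewrite lee_fin; case/andP: (f01 w).
have GT := sub_sigma_fieldT hG.
have hint := Radon_Nikodym_SigmaFinite.f_integrable (dom mB).
have hE := Radon_Nikodym_SigmaFinite.f_integral (dom mB).
rewrite -(integral_restr_sub_sigma_field hG)//; last 2 first.
- exact: (@emeasurable_funM _ S).
- by move=> w; exact: mule_ge0.
rewrite -integral_subprob_restr//; last exact: (measurable_wrt_measurable hG).
rewrite -(integral_restr_sub_sigma_field hG)//.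
rewrite -(Radon_Nikodym_SigmaFinite.change_of_variables (dom mB))//.
apply: ge0_ae_eq_integral => //.
- exact: (@emeasurable_funM _ S).
- apply: (@emeasurable_funM _ S) => //; exact: measurable_int hint.
- by move=> w _; exact: mule_ge0.
- move=> w _; apply: mule_ge0 => //.
  exact: Radon_Nikodym_SigmaFinite.f_ge0 (dom mB) w.
apply: ae_eqe_mul2l; apply/ae_eq_sym; apply: integral_ae_eq => //.
move=> E _ mE; rewrite -hE//.
have GE : G E by rewrite -(sub_sigma_fieldE hG).
by rewrite integral_restr_sub_sigma_field// fE.
Qed.

End cond_prob_version.

(** * L^2 geometry of conditional probabilities *)

Local Open Scope ring_scope.

Lemma bounded_integrable d (T : measurableType d) (R : realType)
    (Q : probability T R) (D : set T) (f : T -> R) (C : R) :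
  measurable D -> measurable_fun setT f -> (forall x, `|f x| <= C) ->
  Q.-integrable D (EFin \o f).
Proof.
move=> mD mf fC; apply: measurable_bounded_integrable => //.
- by rewrite (le_lt_trans (probability_le1 Q mD))// ltry.
- exact: measurable_funTS.
- exists C; split; rewrite ?num_real// => M CM x _ /=.
  exact: le_trans (fC x) (ltW CM).
Qed.

Lemma sqr_integrable d (T : measurableType d) (R : realType)
    (Q : probability T R) (f : T -> R) :
  measurable_fun setT f -> (forall x, 0 <= f x <= 1) ->
  Q.-integrable setT (EFin \o (fun x => f x ^+ 2)).
Proof.
move=> mf f01; apply: (@bounded_integrable _ _ _ _ _ _ 1) => //.
  exact: measurable_funX.
by move=> x; rewrite ger0_norm ?sqr_ge0//; move: (f01 x); nra.
Qed.

Section cond_prob_version_L2.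
Context d (T : measurableType d) (R : realType) (P : probability T R).
Implicit Types (G : set (set T)) (B D : set T) (f g : T -> R).

Lemma cond_prob_version_measurable G B f :
  sub_sigma_field G -> cond_prob_version P G B f -> measurable_fun setT f.
Proof.
move=> hG [mf _ _]; apply/measurable_EFinP.
exact: (measurable_wrt_measurable hG).
Qed.

Lemma cond_prob_version_bounded G B f x :
  cond_prob_version P G B f -> 0 <= f x <= 1.
Proof. by case. Qed.

(** Both sides equal the integral of [g] over [B]: [g] is measurable for [G], which gives the left
    one, and for [G'], which gives the right one. *)
Lemma Rintegral_mul_cond_prob G' G B f g : sub_sigma_field G' ->
  sub_sigma_field G -> G' `<=` G -> measurable B ->
  cond_prob_version P G B f -> cond_prob_version P G' B g ->
  \int[P]_w (f w * g w) = \int[P]_w (g w ^+ 2).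
Proof.
move=> hG' hG sG mB hf hg; have [mg g01 _] := hg.
have g0 w : (0 <= (g w)%:E)%E by rewrite lee_fin; case/andP: (g01 w).
have mg' := measurable_wrt_sub sG mg.
congr fine; transitivity (\int[P]_(w in B) (g w)%:E)%E.
  rewrite -(integral_mule_cond_prob hG mB hf)//.
  by apply: eq_integral => w _; rewrite mulrC EFinM.
by rewrite -(integral_mule_cond_prob hG' mB hg).
Qed.

(** Pythagoras: [g] is the orthogonal projection of [f] onto the [G']-measurable functions. *)
Lemma Rintegral_sqr_sub G' G B f g : sub_sigma_field G' ->
  sub_sigma_field G -> G' `<=` G -> measurable B ->
  cond_prob_version P G B f -> cond_prob_version P G' B g ->
  \int[P]_w ((f w - g w) ^+ 2) =
  \int[P]_w (f w ^+ 2) - \int[P]_w (g w ^+ 2).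
Proof.
move=> hG' hG sG mB hf hg.
have mf := cond_prob_version_measurable hG hf.
have mg := cond_prob_version_measurable hG' hg.
have f01 x := cond_prob_version_bounded x hf.
have g01 x := cond_prob_version_bounded x hg.
have -> : (fun w => (f w - g w) ^+ 2) =
    (fun w => (f w ^+ 2 + g w ^+ 2) - 2 * (f w * g w)).
  by apply/funext => w; ring.
have iff := sqr_integrable P mf f01.
have igg := sqr_integrable P mg g01.
have ifg : P.-integrable setT (EFin \o (fun w => f w * g w)).
  apply: (@bounded_integrable _ _ _ _ _ _ 1) => //.
    exact: measurable_funM.
  by move=> x; rewrite ger0_norm; move: (f01 x) (g01 x); nra.
have i2fg : P.-integrable setT (EFin \o (fun w => 2 * (f w * g w))).
  exact: (integrableZl measurableT 2 ifg).
have isum : P.-integrable setT (EFin \o (fun w => f w ^+ 2 + g w ^+ 2)).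
  exact: (integrableD measurableT iff igg).
rewrite RintegralB// RintegralD// RintegralZl//.
rewrite (Rintegral_mul_cond_prob hG' hG sG mB hf hg); ring.
Qed.

(** Plays the role of Cauchy-Schwarz: L^2 bounds on increments become L^1 bounds, which can be
    summed. *)
Lemma Rintegral_normr_le (Q : probability T R) f (t : R) :
  measurable_fun setT f -> (forall x, `|f x| <= 1) -> 0 < t ->
  \int[Q]_w (f w ^+ 2) <= t ^+ 2 -> \int[Q]_w `|f w| <= t.
Proof.
move=> mf f1 t0 ft.
have iff : Q.-integrable setT (EFin \o (fun w => f w ^+ 2)).
  apply: (@bounded_integrable _ _ _ _ _ _ 1) => //.
    exact: measurable_funX.
  by move=> x; rewrite normrX expr_le1.
have i1 : Q.-integrable setT (EFin \o cst (t / 2)).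
  apply: (@bounded_integrable _ _ _ _ _ _ `|t / 2|) => //.
have i2 : Q.-integrable setT (EFin \o (fun w => (2 * t)^-1 * f w ^+ 2)).
  exact: (integrableZl measurableT (2 * t)^-1 iff).
have i3 : Q.-integrable setT (EFin \o (fun w => t / 2 + (2 * t)^-1 * f w ^+ 2)).
  exact: (integrableD measurableT i1 i2).
apply: (@le_trans _ _ (\int[Q]_w (t / 2 + (2 * t)^-1 * f w ^+ 2))).
  apply: le_Rintegral => //.
    apply: (@bounded_integrable _ _ _ _ _ _ 1) => //.
      exact: measurableT_comp.
    by move=> x; rewrite normr_id.
  (* AM-GM: [`|f| <= t / 2 + f ^ 2 / (2 t)] *)
  move=> x _; rewrite -subr_ge0.
  have -> : t / 2 + (2 * t)^-1 * f x ^+ 2 - `|f x| =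
      (2 * t)^-1 * (t - `|f x|) ^+ 2.
    by rewrite -[f x ^+ 2]real_normK ?num_real//; field; rewrite gt_eqF.
  by rewrite mulr_ge0 ?sqr_ge0// invr_ge0; lra.
rewrite RintegralD// (RintegralZl _ measurableT iff) Rintegral_cst//.
have -> : fine (Q setT) = 1 by rewrite probability_setT.
rewrite mulr1.
apply: (@le_trans _ _ (t / 2 + (2 * t)^-1 * t ^+ 2)).
  by rewrite lerD2l ler_wpM2l// invr_ge0; lra.
by rewrite le_eqVlt; apply/orP; left; apply/eqP; field; rewrite gt_eqF.
Qed.

End cond_prob_version_L2.

(** * Upper limits and dyadic bounds *)

Lemma limn_esup_shift (R : realType) (u : (\bar R)^nat) n :
  limn_esup (fun k => u (k + n)%N) = limn_esup u.
Proof.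
rewrite !limn_esup_lim.
have -> : esups (fun k => u (k + n)%N) = (fun k => esups u (k + n)%N).
  apply/funext => m; congr ereal_sup.
  apply/seteqP; split => [_ [k /= mk <-]|_ [k /= mk <-]].
    by exists (k + n)%N => //=; rewrite leq_add2r.
  exists (k - n)%N; rewrite /= ?leq_subRL ?subnK//; lia.
apply/cvg_lim => //; rewrite (cvg_shiftn n (esups u)).
exact: is_cvg_esups.
Qed.

Lemma limn_esup_bounds (R : realType) (u : (\bar R)^nat) (a b : \bar R) j :
  (forall m, (j <= m)%N -> (a <= u m <= b)%E) -> (a <= limn_esup u <= b)%E.
Proof.
move=> aub; rewrite -(limn_esup_shift u j) limn_esup_lim; apply/andP; split.
  apply: lime_ge; first exact: is_cvg_esups.
  apply: nearW => m.
  have /andP[+ _] := aub (m + j)%N (leq_addl _ _); move/le_trans; apply.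
  by apply: ereal_sup_ubound; exists m => /=.
apply: lime_le; first exact: is_cvg_esups.
apply: nearW => m; apply: ge_ereal_sup => _ [k /= _ <-].
by case/andP: (aub (k + j)%N (leq_addl _ _)).
Qed.

Lemma small_dyadic (R : realType) (x : R) :
  (forall j, x <= (2 ^ j)%:R^-1) -> x <= 0.
Proof.
move=> xj; rewrite leNgt; apply/negP => /ltr_add_invr[k]; rewrite add0r ltNge.
move/negP; apply; apply: le_trans (xj k) _.
by rewrite lef_pV2 ?posrE ?ltr0n ?expn_gt0// ler_nat ltn_expl.
Qed.

(** * Backward convergence *)

Section backward_convergence.
Context d (T : measurableType d) (R : realType) (P : probability T R)
  (G : nat -> set (set T)) (B : set T) (f : nat -> T -> R).
Hypotheses (hG : forall n, sub_sigma_field (G n))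
  (G_decr : forall n, G n.+1 `<=` G n) (mB : measurable B)
  (hf : forall n, cond_prob_version P (G n) B (f n)).

Let A := \bigcap_n G n.

Lemma decreasing_sub m n : (m <= n)%N -> G n `<=` G m.
Proof.
elim: n => [|n IH]; first by rewrite leqn0 => /eqP ->.
rewrite leq_eqVlt => /predU1P[->//|]; rewrite ltnS => /IH.
exact: subset_trans.
Qed.

Lemma sub_sigma_field_bigcap : sub_sigma_field A.
Proof.
split; last by move=> D /(_ 0%N Logic.I); exact: (hG 0%N).2.
by apply: sigma_algebra_bigcap => n _; exact: (hG n).1.
Qed.

Let mf n : measurable_fun setT (f n).
Proof. exact: cond_prob_version_measurable (hG n) (hf n). Qed.

Let f01 n x : 0 <= f n x <= 1.
Proof. exact: cond_prob_version_bounded x (hf n). Qed.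

(** By Pythagoras, the squared L^2 distance between two terms is the difference of their second
    moments [c]. These decrease and are bounded below, so it suffices to pick indices at which [c]
    is within [t k ^+ 2] of its infimum. *)
Lemma rapid_subsequence : exists phi : nat -> nat,
  [/\ forall k, (k <= phi k)%N &
      forall k, \int[P]_x `|f (phi k.+1) x - f (phi k) x| <= (2 ^ k.+1)%:R^-1].
Proof.
pose c n := \int[P]_w (f n w ^+ 2).
have cB m n : (m <= n)%N -> \int[P]_w ((f m w - f n w) ^+ 2) = c m - c n.
  by move=> mn; apply: (Rintegral_sqr_sub (hG n) (hG m) (decreasing_sub mn) mB).
have c_lb : has_lbound (range c).
  by exists 0 => _ [n _ <-]; apply: Rintegral_ge0 => x _; exact: sqr_ge0.
have c_inf : has_inf (range c) by split => //; exists (c 0%N); exists 0%N.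
pose t k : R := (2 ^ k.+1)%:R^-1.
have t0 k : 0 < t k by rewrite invr_gt0 ltr0n expn_gt0.
have /choice[N HN] : forall k, exists n, c n < inf (range c) + t k ^+ 2.
  move=> k; have [_ [n _ <-] cn] := inf_adherent (exprn_gt0 2 (t0 k)) c_inf.
  by exists n.
(* Summing makes [phi] monotone and at least [N k]; the extra summand [k] makes it at least [k]. *)
pose phi k := (k + \sum_(i < k.+1) N i)%N.
have phi_le k : (phi k <= phi k.+1)%N.
  by rewrite /phi [in leqRHS]big_ord_recr/= leq_add// leq_addr.
have Nphi k : (N k <= phi k)%N.
  by rewrite /phi big_ord_recr/= addnA leq_addl.
exists phi; split => [k|k]; first exact: leq_addr.
under eq_Rintegral do rewrite distrC.
apply: Rintegral_normr_le => //.
- exact: measurable_funB.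
- by move=> x; move: (f01 (phi k) x) (f01 (phi k.+1) x); rewrite ler_norml; lra.
(* Chain: c (phi k) <= c (N k) < inf + t k ^ 2, while c (phi k.+1) >= inf. *)
rewrite cB//; have : inf (range c) <= c (phi k.+1).
  by apply: ge_inf => //; exists (phi k.+1).
have : 0 <= c (N k) - c (phi k).
  by rewrite -cB//; apply: Rintegral_ge0 => x _; exact: sqr_ge0.
by have := HN k; rewrite -/(t k); lra.
Qed.

Section limit.
Variable phi : nat -> nat.
Hypotheses (phi_ge : forall k, (k <= phi k)%N)
  (phi_rapid : forall k,
    \int[P]_x `|f (phi k.+1) x - f (phi k) x| <= (2 ^ k.+1)%:R^-1).

(** An upper limit exists at every point, so no null set of divergence has to be removed, which
    could spoil measurability with respect to the intersection [A]. *)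
Let h x := fine (limn_esup (fun k => (f (phi k) x)%:E)).

Let limn01 x : (0 <= limn_esup (fun k => (f (phi k) x)%:E) <= 1)%E.
Proof. by apply: (@limn_esup_bounds _ _ _ _ 0) => m _; rewrite !lee_fin. Qed.

Let hE : EFin \o h = fun x => limn_esup (fun k => (f (phi k) x)%:E).
Proof.
apply/funext => x; rewrite /= fineK//; have /andP[l0 l1] := limn01 x.
by rewrite ge0_fin_numE// (le_lt_trans l1)// ltry.
Qed.

Let h01 x : 0 <= h x <= 1.
Proof.
have -> : h x = fine ((EFin \o h) x) by [].
have := limn01 x; rewrite -(congr1 (fun F => F x) hE)/= !lee_fin//.
Qed.

(* An upper limit does not depend on the first n terms, hence it is
   (G n)-measurable for every n. *)
Let mh_wrt : measurable_wrt A (EFin \o h).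
Proof.
suff mhn n : measurable_wrt (G n) (EFin \o h).
  move=> _ Y mY; rewrite setTI /measurable/=.
  rewrite (sub_sigma_fieldE sub_sigma_field_bigcap) => n _.
  exact: (measurable_wrt_preimage (hG n)).
rewrite hE (_ : (fun x => _) =
    fun x => limn_esup (fun k => (f (phi (k + n)) x)%:E)).
  apply: (@measurable_fun_limn_esup _ (g_sigma_algebraType (G n))) => k.
  have [m _ _] := hf (phi (k + n)); apply: measurable_wrt_sub m.
  by apply: decreasing_sub; exact: leq_trans (leq_addl _ _) (phi_ge _).
by apply/funext => x; rewrite -(limn_esup_shift _ n).
Qed.

Let mh : measurable_fun setT h.
Proof.
apply/measurable_EFinP.
exact: (measurable_wrt_measurable sub_sigma_field_bigcap mh_wrt).
Qed.

Let Delta k x := `|f (phi k.+1) x - f (phi k) x|.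

(** Telescoping: every later term lies within the tail sum of the increments from [f (phi j) x],
    hence so does the upper limit. Where the tail sum is infinite the bound is trivial. *)
Let h_dist j x :
  (`|f (phi j) x - h x|%:E <= \sum_(0 <= k <oo) (Delta (k + j) x)%:E)%E.
Proof.
set S := (\sum_(_ <= _ <oo) _)%E.
have S0 : (0 <= S)%E.
  by apply: nneseries_ge0 => k _ _; rewrite lee_fin normr_ge0.
have fS m : (j <= m)%N -> (`|f (phi m) x - f (phi j) x|%:E <= S)%E.
  move=> jm.
  apply: le_trans (@nneseries_lim_ge _ _ xpredT 0 (m - j) _); last first.
    by move=> k _ _; rewrite lee_fin normr_ge0.
  rewrite sumEFin lee_fin -{1}(subnK jm).
  elim: (m - j)%N => [|n IH]; first by rewrite add0n subrr normr0 big_nil.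
  rewrite big_nat_recr//= addrC addSn.
  by apply: le_trans (lerD (lexx _) IH); rewrite /Delta ler_distD.
move: fS S0; case: S => [s fS s0| _ _|//]; last by rewrite leey.
have : ((f (phi j) x - s)%:E <= (EFin \o h) x <= (f (phi j) x + s)%:E)%E.
  rewrite hE; apply: (@limn_esup_bounds _ _ _ _ j) => m jm.
  by have := fS m jm; rewrite !lee_fin ler_norml; lra.
by rewrite /= !lee_fin ler_norml; lra.
Qed.

Let integrable_dist j :
  P.-integrable setT (EFin \o (fun x => `|f (phi j) x - h x|)).
Proof.
apply: (@bounded_integrable _ _ _ _ _ _ 1) => //.
  by apply: measurableT_comp => //; exact: measurable_funB.
move=> x; rewrite normr_id ler_norml.
by move: (f01 (phi j) x) (h01 x); lra.
Qed.

Let int_dist j : \int[P]_x `|f (phi j) x - h x| <= (2 ^ j)%:R^-1.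
Proof.
have id k : P.-integrable setT (EFin \o Delta k).
  apply: (@bounded_integrable _ _ _ _ _ _ 1) => //.
    by apply: measurableT_comp => //; exact: measurable_funB.
  move=> x; rewrite normr_id ler_norml.
  by move: (f01 (phi k) x) (f01 (phi k.+1) x); lra.
have ih := integrable_dist j.
rewrite -lee_fin fineK; last exact: integrable_fin_num ih.
have mD k : measurable_fun setT (fun x => (Delta k x)%:E).
  exact: measurable_int (id k).
apply: (@le_trans _ _ (\int[P]_x \sum_(0 <= k <oo) (Delta (k + j) x)%:E)%E).
  apply: ge0_le_integral => //.
  - exact: measurable_int ih.
  - by apply: ge0_emeasurable_sum => // k x _; rewrite lee_fin normr_ge0.
rewrite integral_nneseries//; last by move=> k x _; rewrite lee_fin normr_ge0.
have p0 : 0 <= (2 ^ j)%:R^-1 :> R by rewrite invr_ge0 ler0n.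
(* Geometric series: the k-th increment of the tail has integral at most 2^-j / 2^(k+1). *)
apply: le_trans (epsilon_trick0 xpredT p0).
apply: lee_nneseries => [k _ _|k _].
  by apply: integral_ge0 => x _; rewrite lee_fin normr_ge0.
rewrite -[leLHS]fineK; last exact: integrable_fin_num (id _).
rewrite lee_fin; apply: le_trans (phi_rapid _) _.
by rewrite -addSn expnD natrM invfM mulrC.
Qed.

(** A set [D] of [A] lies in each [G (phi j)], so [f (phi j)] has integral P(D ∩ B) over it; the
    integral of [h] over [D] is within 2^-j of this for every [j]. *)
Lemma cond_prob_version_limit : cond_prob_version P A B h.
Proof.
split => // D AD.
have mD : measurable D by exact: (hG 0%N).2 (AD 0%N Logic.I).
have iD (g : T -> R) : measurable_fun setT g -> (forall x, 0 <= g x <= 1) ->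
    P.-integrable D (EFin \o g).
  move=> mg g01; apply: (@bounded_integrable _ _ _ _ _ _ 1) => //.
  by move=> x; rewrite ler_norml; move: (g01 x); lra.
have ihD := iD _ mh h01; have ifD n := iD _ (@mf n) (f01 n).
rewrite -[LHS]fineK; last exact: integrable_fin_num ihD.
rewrite -[RHS]fineK; last by apply: fin_num_measure; exact: measurableI.
congr EFin; apply/eqP; rewrite -subr_eq0 -normr_le0; apply: small_dyadic => j.
have [_ _ <-] := hf (phi j); last exact: AD.
change (`|\int[P]_(w in D) h w - \int[P]_(w in D) f (phi j) w| <=
  (2 ^ j)%:R^-1).
rewrite distrC -RintegralB//.
apply: le_trans (int_dist j); apply: le_trans (le_normr_Rintegral mD _) _.
  exact: (integrableB mD (ifD _) ihD).
have ih := integrable_dist j.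
apply: fine_le.
- by apply: integrable_fin_num => //; exact: (integrableS measurableT).
- exact: integrable_fin_num.
- apply: ge0_subset_integral => //; exact: measurable_int ih.
Qed.

Lemma Rintegral_sqr_limit j :
  \int[P]_x (f (phi j) x ^+ 2) <= \int[P]_x (h x ^+ 2) + 2 * (2 ^ j)%:R^-1.
Proof.
have ihX := sqr_integrable P mh h01.
have ifX := sqr_integrable P (@mf (phi j)) (f01 (phi j)).
have i2 : P.-integrable setT (EFin \o (fun x => 2 * `|f (phi j) x - h x|)).
  exact: (integrableZl measurableT 2 (integrable_dist j)).
apply: (@le_trans _ _ (\int[P]_x (h x ^+ 2 + 2 * `|f (phi j) x - h x|))).
  apply: le_Rintegral => //; first exact: (integrableD measurableT ihX i2).
  (* On [0, 1] squaring is 2-Lipschitz. *)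
  move=> x _; have := ler_norm (f (phi j) x - h x).
  have := ler_norm (- (f (phi j) x - h x)); rewrite normrN.
  by move: (f01 (phi j) x) (h01 x); nra.
rewrite RintegralD// (RintegralZl _ measurableT (integrable_dist j)).
by rewrite lerD2l ler_wpM2l// int_dist.
Qed.

End limit.

Lemma cond_prob_version_L2_backward g (e : R) :
  cond_prob_version P A B g -> 0 < e ->
  exists n, \int[P]_x (f n x ^+ 2) <= \int[P]_x (g x ^+ 2) + e.
Proof.
move=> hg e0; have [phi [phi_ge phi_rapid]] := rapid_subsequence.
have hh := cond_prob_version_limit phi_ge phi_rapid.
have hA := sub_sigma_field_bigcap.
(* Two versions given the same sigma-field have equal second moments, as each equals the integral of
   their product. *)
have <- : \int[P]_x (fine (limn_esup (fun k => (f (phi k) x)%:E)) ^+ 2) =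
    \int[P]_x (g x ^+ 2).
  rewrite -(Rintegral_mul_cond_prob hA hA _ mB hg hh)//.
  rewrite -(Rintegral_mul_cond_prob hA hA _ mB hh hg)//.
  by apply: eq_Rintegral => x _; rewrite mulrC.
have : 0 < e / 2 by lra.
move=> /ltr_add_invr[k]; rewrite add0r => ke.
exists (phi k); apply: le_trans (Rintegral_sqr_limit phi_ge phi_rapid k) _.
rewrite lerD2l.
have : (2 ^ k)%:R^-1 <= k.+1%:R^-1 :> R.
  by rewrite lef_pV2 ?posrE ?ltr0n ?expn_gt0// ler_nat ltn_expl.
move/le_lt_trans => /(_ _ ke); set t := _^-1; lra.
Qed.

End backward_convergence.

(** * The zero-one law *)

(** The finite intersections of generators, indexed by lists of codes: concatenation of lists is
    intersection and the empty list gives the whole space. The index type is countable, so a.e.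
    statements can be intersected over it. *)
Lemma countably_generated_pi_system (T : pointedType) (G : set (set T)) :
  sigma_algebra setT G -> countably_generated G ->
  exists D : seq nat -> set T,
    [/\ forall s, G (D s), D [::] = setT, setI_closed (range D) &
        <<s range D >> = G].
Proof.
move=> sG [C [/countable_injP[p p_inj] CG <-]].
(* A number that codes no member of [C] imposes no condition. *)
pose D (s : seq nat) : set T := \bigcap_(X in [set X | C X /\ p X \in s]) X.
have D0 : D [::] = setT by apply/seteqP; split => // x _ X [].
have DI s t : D s `&` D t = D (s ++ t).
  rewrite /D -bigcap_setU; congr bigcap; apply/seteqP; split => X /=.
    by case=> -[CX Xs]; split => //; rewrite mem_cat Xs ?orbT.
  by case=> CX; rewrite mem_cat => /orP[|] Xs; [left|right].
have D1 X : C X -> D [:: p X] = X.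
  move=> CX; apply/seteqP; split => x.
    by apply; split => //; rewrite inE.
  by move=> Xx Y [CY]; rewrite inE => /eqP /p_inj; rewrite !inE => -> //.
have CD : C `<=` range D by move=> X CX; exists [:: p X] => //; exact: D1.
have sgD s : <<s C >> (D s).
  elim: s => [|n s IH].
    by rewrite D0; exact: (@measurableT _ (g_sigma_algebraType C)).
  rewrite -cat1s -DI; apply: (@measurableI _ (g_sigma_algebraType C)) => //.
  have [[X [CX <-]]|nX] := pselect (exists X, C X /\ p X = n).
    by rewrite D1//; exact: sub_sigma_algebra.
  have -> : D [:: n] = setT.
    apply/seteqP; split => // x _ X [CX]; rewrite inE => /eqP Xn.
    by exfalso; apply: nX; exists X.
  exact: (@measurableT _ (g_sigma_algebraType C)).
exists D; split => //.
- by move=> _ _ [s _ <-] [t _ <-]; exists (s ++ t).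
- apply/seteqP; split; last exact: sub_sigma_algebra2.
  apply: smallest_sub; first exact: smallest_sigma_algebra.
  by move=> _ [s _ <-].
Qed.

Lemma sub_sigma_field_bigcap_countable d (T : measurableType d) (R : realType)
    (P : probability T R) (G : set (set T)) (I : countType) (F : I -> set T) :
  sub_sigma_field G -> (forall i, G (F i)) -> (forall i, P (F i) = 1%E) ->
  G (\bigcap_i F i) /\ P (\bigcap_i F i) = 1%E.
Proof.
move=> hG GF PF.
(* Numbers that decode to nothing get the whole space, which changes neither the intersection nor
   its probability. *)
pose F' n := if unpickle n is Some i then F i else setT.
have -> : \bigcap_i F i = \bigcap_n F' n.
  apply/seteqP; split => w wF i _.
    by rewrite /F'; case: unpickle => // j; exact: wF.
  by have := wF (pickle i) Logic.I; rewrite /F' pickleK.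
have GF' n : G (F' n).
  by rewrite /F'; case: unpickle => // ; exact: (sub_sigma_fieldT hG).
have PF' n : P (F' n) = 1%E.
  by rewrite /F'; case: unpickle => // ; exact: probability_setT.
have GI : G (\bigcap_n F' n).
  rewrite -(sub_sigma_fieldE hG).
  apply: (@bigcapT_measurable _ (g_sigma_algebraType G)) => n.
  by rewrite /measurable/= (sub_sigma_fieldE hG).
have mI := hG.2 _ GI; split => //.
have aeF n : {ae P, forall w, F' n w}.
  by apply/(probability1P P (hG.2 _ (GF' n))).
apply/(probability1P _ mI).
by apply: filterS (ae_foralln aeF) => w wF n _; exact: wF.
Qed.

(* The right-hand side is the integral of [(f - a + t 1_E)^2]. *)
Lemma variance_perturbation_ge0 d (T : measurableType d) (R : realType)
    (Q : probability T R) (f : T -> R) (E : set T) (a t : R) :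
  measurable_fun setT f -> (forall x, 0 <= f x <= 1) -> measurable E ->
  a = \int[Q]_x f x ->
  0 <= \int[Q]_x (f x ^+ 2) - a ^+ 2 +
    2 * t * (\int[Q]_(x in E) f x - a * fine (Q E)) + t ^+ 2 * fine (Q E).
Proof.
move=> mf f01 mE aE.
have iff := sqr_integrable Q mf f01.
have i1 : Q.-integrable setT (EFin \o f).
  apply: (@bounded_integrable _ _ _ _ _ _ 1) => //.
  by move=> x; rewrite ler_norml; move: (f01 x); lra.
have iE : Q.-integrable setT (EFin \o (fun w => \1_E w : R)).
  apply: (@bounded_integrable _ _ _ _ _ _ 1) => //.
    exact: measurable_indic.
  by move=> x; rewrite indicE; case: (x \in E); rewrite ?normr1 ?normr0.
have ifE : Q.-integrable setT (EFin \o (fun w => f w * \1_E w)).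
  apply: (@bounded_integrable _ _ _ _ _ _ 1) => //.
    exact: measurable_funM.
  move=> x; rewrite indicE ler_norml.
  by move: (f01 x); case: (x \in E) => /=; lra.
have iZ (c : R) g : Q.-integrable setT (EFin \o g) ->
    Q.-integrable setT (EFin \o (fun w => c * g w)).
  by move=> ig; exact: (integrableZl measurableT c ig).
have iD (g h : T -> R) :
    Q.-integrable setT (EFin \o g) -> Q.-integrable setT (EFin \o h) ->
    Q.-integrable setT (EFin \o (fun w => g w + h w)).
  by move=> ig ih; exact: (integrableD measurableT ig ih).
have ia : Q.-integrable setT (EFin \o cst (a ^+ 2)).
  by apply: (@bounded_integrable _ _ _ _ _ _ `|a ^+ 2|).
have : 0 <= \int[Q]_x ((f x - a + t * \1_E x) ^+ 2).
  by apply: Rintegral_ge0 => x _; exact: sqr_ge0.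
have -> : (fun x => (f x - a + t * \1_E x) ^+ 2) =
    (fun x => (f x ^+ 2 + (- (2 * a)) * f x) +
      (cst (a ^+ 2) x +
        (2 * t * (f x * \1_E x) + (t ^+ 2 - 2 * a * t) * \1_E x))).
  by apply/funext => x; rewrite indicE /cst; case: (x \in E) => /=; ring.
rewrite RintegralD//; [|exact: (iD _ _ _ (iZ _ _ _))|
  exact: (iD _ _ _ (iD _ _ (iZ _ _ _) (iZ _ _ _)))].
rewrite RintegralD//; [|exact: iZ].
rewrite RintegralD//; [|exact: (iD _ _ (iZ _ _ _) (iZ _ _ _))].
rewrite RintegralD//; [|exact: iZ|exact: iZ].
rewrite (RintegralZl _ measurableT i1) (RintegralZl _ measurableT ifE).
rewrite (RintegralZl _ measurableT iE).
rewrite Rintegral_cst// -aE.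
have -> : fine (Q setT) = 1 by rewrite probability_setT.
have -> : \int[Q]_x (\1_E x) = fine (Q E).
  by rewrite /Rintegral integral_indic// setIT.
have -> : \int[Q]_x (f x * \1_E x) = \int[Q]_(x in E) f x.
  rewrite [RHS]Rintegral_mkcond; apply: eq_Rintegral => x _.
  by rewrite patchE indicE; case: (x \in E); rewrite ?mulr1 ?mulr0.
by move/le_trans; apply; rewrite le_eqVlt; apply/orP; left; apply/eqP; ring.
Qed.

Local Open Scope ereal_scope.

(** Dynkin's argument: the sets [E] satisfying the identity are stable under complements, by
    subtraction from the case of [setT], and under countable disjoint unions. *)
Lemma cond_prob_on_pi_system d (T : measurableType d) (R : realType)
    (Q : probability T R) (C : set (set T)) (B : set T) (f : T -> R) :
  C `<=` measurable -> setI_closed C -> C setT -> measurable B ->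
  measurable_fun setT f -> (forall x, (0 <= f x <= 1)%R) ->
  (forall E, C E -> \int[Q]_(x in E) (f x)%:E = Q (E `&` B)) ->
  forall E, <<s C >> E -> \int[Q]_(x in E) (f x)%:E = Q (E `&` B).
Proof.
move=> Cm CI CT mB mf f01 CE.
have f0 x : 0 <= (f x)%:E by rewrite lee_fin; case/andP: (f01 x).
have mfE : measurable_fun setT (fun x => (f x)%:E) by exact/measurable_EFinP.
have sm E : <<s C >> E -> measurable E.
  by apply: smallest_sub => //; exact: sigma_algebra_measurable.
apply: (@dynkin_induction _ (g_sigma_algebraType C) C) => //.
- exact: CE.
- move=> S /sm mS QS; have mCS := measurableC mS.
  have := CE setT CT; rewrite -(setUv S) ge0_integral_setU//; last 2 first.
  - by rewrite setUv.
  - by apply/disj_setPS; rewrite setICr.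
  rewrite setIUl measureU//; last 3 first.
  - exact: measurableI.
  - exact: measurableI.
  - by rewrite setIACA setICr set0I.
  rewrite QS addeC [RHS]addeC => /(congr1 (fun z => z - Q (S `&` B))).
  by rewrite !addeK// fin_num_measure//; exact: measurableI.
- move=> F mF tF QF.
  have mF' n : d.-measurable (F n : set T) by apply: sm; exact: mF.
  rewrite ge0_integral_bigcup//; last first.
    by apply: measurable_funS mfE.
  rewrite setI_bigcupl measure_bigcup//; last 2 first.
  - by move=> n _; exact: measurableI.
  - exact: trivIset_setIr.
  rewrite [RHS]eseries_mkcond; apply: eq_eseriesr => n _.
  by rewrite mem_setT; exact: QF.
Qed.

(** The difference of [Y] and [Z] is a.e. nonnegative with nonpositive integral, so its absolute
    value integrates to 0. *)
Lemma ae_eq_of_le_integral d (T : measurableType d) (R : realType)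
    (P : probability T R) (Y Z : T -> \bar R) :
  measurable_fun setT Y -> measurable_fun setT Z ->
  (forall w, 0 <= Y w <= 1) -> (forall w, 0 <= Z w <= 1) ->
  \int[P]_w Y w <= \int[P]_w Z w -> {ae P, forall w, Z w <= Y w} ->
  {ae P, forall w, Y w = Z w}.
Proof.
move=> mY mZ Y01 Z01 YZ ZY.
have fin (X : T -> \bar R) w : (forall w, 0 <= X w <= 1) -> X w \is a fin_num.
  move=> X01; have /andP[X0 X1] := X01 w.
  by rewrite ge0_fin_numE// (le_lt_trans X1)// ltry.
have int X : measurable_fun setT X -> (forall w, 0 <= X w <= 1) ->
    P.-integrable setT X.
  move=> mX X01; apply/integrableP; split=> //.
  apply: (@le_lt_trans _ _ (\int[P]_w cst 1 w)).
    apply: ge0_le_integral => //; first exact: measurableT_comp.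
    by move=> w _; have /andP[X0 X1] := X01 w; rewrite gee0_abs.
  rewrite integral_cst// mul1e; apply: (@le_lt_trans _ _ 1); last exact: ltry.
  exact: probability_le1.
have iY := int _ mY Y01; have iZ := int _ mZ Z01.
have mYZ : measurable_fun setT (Y \- Z) by exact: emeasurable_funB.
have : \int[P]_w `|(Y \- Z) w| = 0.
  apply/eqP; rewrite eq_le; apply/andP; split; last exact: integral_ge0.
  rewrite (@ae_eq_integral _ _ _ _ _ (Y \- Z))//; last 2 first.
  - exact: measurableT_comp.
  - apply: filterS ZY => w ZYw _ /=; rewrite gee0_abs// sube_ge0// fin//.
  rewrite integralB// leeBlDr ?add0e//.
  exact: integrable_fin_num.
move/(ae_eq_integral_abs _ measurableT mYZ).
apply: filterS => w /(_ Logic.I) /= /eqP.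
by rewrite sube_eq ?fin// ?fin_num_adde_defl ?fin// add0e => /eqP.
Qed.

Local Open Scope ring_scope.

Lemma rcd_cond_prob_version d (T : measurableType d) (R : realType)
    (P : probability T R) (G : set (set T)) (mu : T -> probability T R) B :
  sub_sigma_field G -> regular_cond_distr P G mu -> measurable B ->
  cond_prob_version P G B (fun w => fine (mu w B)).
Proof.
move=> hG hmu mB; have [mm _ intB] := hmu _ mB.
have muE : EFin \o (fun w => fine (mu w B)) = mu ^~ B.
  by apply/funext => w /=; rewrite fineK// fin_num_measure.
split.
- by rewrite muE.
- move=> w; rewrite fine_ge0//=.
  by rewrite -lee_fin fineK ?fin_num_measure// probability_le1.
- move=> D GD; have -> : (fun w => (fine (mu w B))%:E) = mu ^~ B := muE.
  rewrite intB//; have mD : measurable D := hG.2 _ GD.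
  by rewrite integral_indic// setIC.
Qed.

(** * Independence under the conditional measures *)

Section zero_one.
Context d (T : measurableType d) (R : realType) (P : probability T R)
  (G : nat -> set (set T)) (mu : T -> probability T R).
Hypotheses (hG : forall n, sub_sigma_field (G n))
  (G_decr : forall n, G n.+1 `<=` G n)
  (G_cg : forall n, countably_generated (G n)).

Let A := \bigcap_n G n.

Hypothesis hmu : regular_cond_distr P A mu.

Let hA : sub_sigma_field A := sub_sigma_field_bigcap hG.

(** Both sides are [A]-measurable in [w]. Over [E] in [A] both integrate to P(E ∩ D ∩ B): for the
    left one, disintegrate and use that E ∩ D belongs to [G n]. Uniqueness given [A] concludes. *)
Lemma rcd_integral_cond_prob n D B f : measurable B -> G n D ->
  cond_prob_version P (G n) B f ->
  A [set w | \int[mu w]_(x in D) (f x)%:E = mu w (D `&` B)]%E /\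
  P [set w | \int[mu w]_(x in D) (f x)%:E = mu w (D `&` B)]%E = 1%E.
Proof.
move=> mB GD hf; have [_ f01 fE] := hf.
have mD := (hG n).2 _ GD; have mDB := measurableI _ _ mD mB.
have mf : measurable_fun setT (EFin \o f).
  by apply/measurable_EFinP; exact: cond_prob_version_measurable (hG n) hf.
have f0 x : (0 <= (f x)%:E)%E by rewrite lee_fin; case/andP: (f01 x).
pose u := (EFin \o f) \_ D.
have u_meas : measurable_fun setT u :=
  (measurable_restrictT (EFin \o f) mD).1 (measurable_funTS mf).
have u0 x : (0 <= u x)%E by apply: erestrict_ge0 => y _; exact: f0.
have uE w : (\int[mu w]_(x in D) (f x)%:E = \int[mu w]_x u x)%E.
  by rewrite integral_mkcond.
have -> : [set w | \int[mu w]_(x in D) (f x)%:E = mu w (D `&` B)]%E =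
   [set w | \int[mu w]_x u x = mu w (D `&` B)]%E.
  by apply/seteqP; split => w /=; rewrite uE.
have [mmu _ intmu] := hmu mDB.
have mI := measurable_wrt_integral_rcd hmu u_meas u0.
have YZ E : A E -> (\int[P]_(w in E) \int[mu w]_x u x =
    \int[P]_(w in E) mu w (D `&` B))%E.
  move=> AE; have mE := hA.2 _ AE.
  rewrite (disintegration hA hmu u_meas u0 AE) intmu// integral_indic//.
  rewrite -integral_mkcondr fE; last first.
    rewrite -(sub_sigma_fieldE (hG n)).
    by apply: (@measurableI _ (g_sigma_algebraType (G n)));
      rewrite /measurable/= (sub_sigma_fieldE (hG n))//; exact: AE.
  by congr (P _); rewrite [RHS]setIC setIA.
split; first exact: (sub_sigma_field_eqset hA).
apply: (cond_exp_unique hA) => //.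
- by move=> w; exact: integral_ge0.
- rewrite (YZ _ (sub_sigma_fieldT hA)).
  rewrite intmu; last exact: (sub_sigma_fieldT hA).
  rewrite integral_indic// (le_lt_trans (probability_le1 P _)) ?ltry//.
  exact: measurableI.
Qed.

(** [Y w] is the infimum over all [n] of the second moments under [mu w]. Nonnegativity of the
    variance gives Z <= Y a.e., and backward convergence gives the reverse inequality between
    integrals. *)
Lemma rcd_sqr_inf B (f : nat -> T -> R) : measurable B ->
  (forall n, cond_prob_version P (G n) B (f n)) ->
  let Y w := einfs (fun n => \int[mu w]_x ((f n x) ^+ 2)%:E)%E 0 in
  let Z w := (fine (mu w B) ^+ 2)%:E in
  A [set w | Y w = Z w] /\ P [set w | Y w = Z w] = 1%E.
Proof.
move=> mB hf Y Z.
have hg := rcd_cond_prob_version hA hmu mB.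
set g := fun w => fine (mu w B) in hg.
have [mg g01 _] := hg.
have f01 n x : 0 <= f n x <= 1 by exact: cond_prob_version_bounded (hf n).
have mf n : measurable_fun setT (f n).
  exact: cond_prob_version_measurable (hG n) (hf n).
have mf2 n : measurable_fun setT (fun x => ((f n x) ^+ 2)%:E).
  by apply/measurable_EFinP; exact: measurable_funX.
have f20 n x : (0 <= ((f n x) ^+ 2)%:E)%E by rewrite lee_fin sqr_ge0.
have f21 (Q : probability T R) n : (\int[Q]_x ((f n x) ^+ 2)%:E <= 1)%E.
  apply: (@le_trans _ _ (\int[Q]_x cst 1%E x)%E).
    apply: ge0_le_integral => // x _.
    by rewrite lee_fin; move: (f01 n x); nra.
  by rewrite integral_cst// mul1e probability_le1.
have mYA : measurable_wrt A Y.
  apply: (@measurable_fun_einfs _ (g_sigma_algebraType A)) => n.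
  exact: (measurable_wrt_integral_rcd hmu (mf2 n) (f20 n)).
have mZA : measurable_wrt A Z.
  have mg' : measurable_fun [set: g_sigma_algebraType A] g.
    exact/measurable_EFinP.
  apply/measurable_EFinP.
  exact: (@measurable_funX _ (g_sigma_algebraType A)).
have mY := measurable_wrt_measurable hA mYA.
have mZ := measurable_wrt_measurable hA mZA.
have Yle w n : (Y w <= \int[mu w]_x ((f n x) ^+ 2)%:E)%E.
  by apply: ereal_inf_lbound; exists n.
have Y0 w : (0 <= Y w)%E.
  by apply: le_ereal_inf_tmp => _ [n _ <-]; exact: integral_ge0.
have AYZ := sub_sigma_field_eqset hA mYA mZA.
split => //; apply/(probability1P _ (hA.2 _ AYZ)).
apply: ae_eq_of_le_integral => //.
- by move=> w; rewrite Y0 (le_trans (Yle w 0%N)).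
- by move=> w; rewrite !lee_fin sqr_ge0/=; move: (g01 w); rewrite -/(g w); nra.
(* For a suitable [n], the integral of [Y] is at most that of [f n ^+ 2] under [P], by
   disintegration, and this is at most the integral of [Z] plus [e]. *)
- apply/lee_addgt0Pr => e e0.
  have [n] := cond_prob_version_L2_backward hG G_decr mB hf hg e0.
  rewrite -lee_fin EFinD !fineK; last 2 first.
  - have mgT := cond_prob_version_measurable hA hg.
    exact: (integrable_fin_num measurableT (sqr_integrable P mgT g01)).
  - exact: (integrable_fin_num measurableT (sqr_integrable P (mf n) (f01 n))).
  apply: le_trans.
  rewrite -(disintegration hA hmu (mf2 n) (f20 n) (sub_sigma_fieldT hA)).
  apply: ge0_le_integral => //.
  apply: (measurable_wrt_measurable hA).
  exact: (measurable_wrt_integral_rcd hmu (mf2 n) (f20 n)).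
pose M n := [set w | \int[mu w]_(x in setT) (f n x)%:E = mu w (setT `&` B)]%E.
have [AT PT] : A (\bigcap_n M n) /\ P (\bigcap_n M n) = 1%E.
  apply: sub_sigma_field_bigcap_countable => // n.
    by have [] := rcd_integral_cond_prob mB (sub_sigma_fieldT (hG n)) (hf n).
  by have [] := rcd_integral_cond_prob mB (sub_sigma_fieldT (hG n)) (hf n).
move/(probability1P _ (hA.2 _ AT)): PT; apply: filterS => w wT.
apply: le_ereal_inf_tmp => _ [n _ <-].
have aE : g w = \int[mu w]_x f n x.
  by have := wT n Logic.I; rewrite /M/= setTI /g => <-.
(* With t = 0 only the variance remains. *)
have := variance_perturbation_ge0 0 (mf n) (f01 n) measurableT aE.
rewrite mulr0 mul0r addr0 expr0n/= mul0r addr0 subr_ge0 -lee_fin fineK//.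
by apply: integrable_fin_num => //; exact: sqr_integrable.
Qed.

(** The set [N] is fixed before [E]: it only records countably many identities, on pi-systems
    generating the [G n], and the vanishing of the infimum of the variances. *)
Lemma rcd_indep B : measurable B ->
  exists N, [/\ A N, P N = 1%E & forall w E, N w -> A E ->
    mu w (E `&` B) = (mu w E * mu w B)%E].
Proof.
move=> mB.
have /choice[f hf] : forall n, exists f, cond_prob_version P (G n) B f.
  by move=> n; exact: cond_prob_version_exists.
have /choice[D hD] := fun n => countably_generated_pi_system (hG n).1 (G_cg n).
pose N1 (ns : nat * seq nat) :=
  [set w | \int[mu w]_(x in D ns.1 ns.2) (f ns.1 x)%:E =
    mu w (D ns.1 ns.2 `&` B)]%E.
have [AN1 PN1] : A (\bigcap_ns N1 ns) /\ P (\bigcap_ns N1 ns) = 1%E.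
  by apply: sub_sigma_field_bigcap_countable => // -[n s];
    have [GD _ _ _] := hD n;
    have [] := rcd_integral_cond_prob mB (GD s) (hf n).
have [AN2 PN2] := rcd_sqr_inf mB hf.
set N2 := [set w | _] in AN2 PN2.
have [AN PN] : A (\bigcap_b if b then \bigcap_ns N1 ns else N2) /\
    P (\bigcap_b if b then \bigcap_ns N1 ns else N2) = 1%E.
  by apply: sub_sigma_field_bigcap_countable => //; case.
eexists; split; [exact: AN|exact: PN|move=> w E wN AE].
have wN1 := wN true Logic.I; have wN2 := wN false Logic.I.
have mE := hA.2 _ AE.
have f01 n x : 0 <= f n x <= 1 by exact: cond_prob_version_bounded (hf n).
have mf n : measurable_fun setT (f n).
  exact: cond_prob_version_measurable (hG n) (hf n).
have intE n F : G n F -> (\int[mu w]_(x in F) (f n x)%:E = mu w (F `&` B))%E.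
  have [GD D0 DI DG] := hD n; rewrite -DG.
  apply: cond_prob_on_pi_system => //.
  - by move=> _ [s _ <-]; exact: (hG n).2.
  - by exists [::].
  - by move=> _ [s _ <-]; exact: (wN1 (n, s) Logic.I).
(* As [E] lies in every [G n], this is the covariance under [mu w] of [f n] and the indicator of
   [E], whatever [n] is; its square is bounded by each variance, hence by their infimum 0. *)
pose x := fine (mu w (E `&` B)) - fine (mu w B) * fine (mu w E).
have xle n :
    ((x ^+ 2 + fine (mu w B) ^+ 2)%:E <= \int[mu w]_x ((f n x) ^+ 2)%:E)%E.
  have aE : fine (mu w B) = \int[mu w]_x f n x.
    by rewrite /Rintegral (intE n setT) ?setTI//; exact: sub_sigma_fieldT.
  (* [t = - x] makes the perturbed variance at most
     [\int f_n ^ 2 - mu w B ^ 2 - x ^ 2]. *)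
  have := variance_perturbation_ge0 (- x) (mf n) (f01 n) mE aE.
  have -> : \int[mu w]_(x in E) f n x = fine (mu w (E `&` B)).
    by rewrite /Rintegral intE//; exact: AE.
  rewrite -/x -[X in (_ <= X)%E]fineK; last first.
    by apply: integrable_fin_num => //; exact: sqr_integrable.
  rewrite lee_fin -/(Rintegral _ _ _).
  have : 0 <= fine (mu w E) <= 1.
    by rewrite fine_ge0//= -lee_fin fineK ?fin_num_measure// probability_le1.
  rewrite /Rintegral; set I := fine _; set q := fine _; nra.
have : ((x ^+ 2 + fine (mu w B) ^+ 2)%:E <= (fine (mu w B) ^+ 2)%:E)%E.
  by rewrite -wN2; apply: le_ereal_inf_tmp => _ [n _ <-].
rewrite lee_fin gerDr => x20.
have /eqP : x ^+ 2 == 0 by rewrite eq_le x20 sqr_ge0.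
move/eqP; rewrite sqrf_eq0 subr_eq0 => /eqP xE.
rewrite -[LHS]fineK; last by rewrite fin_num_measure//; exact: measurableI.
by rewrite xE EFinM !fineK ?fin_num_measure// muleC.
Qed.

End zero_one.

(** The finite measures Q(. ∩ E) and Q(E) Q agree on the pi-system [C], hence on the sigma-field it
    generates. That contains [E] itself, where the equality reads q = q^2. *)
Lemma zero_one_of_indep_pi_system d (T : measurableType d) (R : realType)
    (Q : probability T R) (C : set (set T)) (E : set T) :
  C `<=` measurable -> setI_closed C -> C setT -> <<s C >> E ->
  (forall B, C B -> Q (E `&` B) = Q E * Q B)%E -> Q E = 0%E \/ Q E = 1%E.
Proof.
move=> Cm CI CT CE QE.
have mE : measurable E.
  by apply: (smallest_sub _ Cm) CE; exact: sigma_algebra_measurable.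
have q0 : 0 <= fine (Q E) by exact: fine_ge0.
have QEE : (fine (Q E))%:E = Q E by rewrite fineK// fin_num_measure.
have QB B : C B -> mrestr Q mE B = mscale (NngNum q0) Q B.
  by move=> CB; rewrite /mrestr/= setIC QE// /mscale/= QEE.
have cover : \bigcup_(_ : nat) [set: T] = setT.
  by apply/seteqP; split => // x _; exists 0%N.
have : mrestr Q mE E = mscale (NngNum q0) Q E.
  apply: (g_sigma_algebra_measure_unique C Cm
    (fun=> setT) (fun=> CT) cover) => //.
  move=> _; apply: le_lt_trans (ltry 1).
  by apply: probability_le1; exact: measurableI.
rewrite /mrestr/mscale/= setIid -{1 3}QEE -EFinM => -[].
move/eqP; rewrite -subr_eq0 -{1}[fine _]mulr1 -mulrBr mulf_eq0 subr_eq0.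
by case/orP => /eqP q; [left|right]; rewrite -QEE ?q// -q.
Qed.

Local Open Scope ereal_scope.

Theorem theorem15 (d : measure_display) (T : measurableType d) (R : realType)
    (P : probability T R) (An : nat -> set (set T)) (A : set (set T))
    (mu : T -> probability T R)
    (hsub : forall n, (1 <= n)%N -> sub_sigma_field (An n))
    (hdecr : forall n, (1 <= n)%N -> An n.+1 `<=` An n)
    (hcg : forall n, (1 <= n)%N -> countably_generated (An n))
    (hA : A = \bigcap_(n in [set n | (1 <= n)%N]) An n)
    (hmu : regular_cond_distr P A mu) :
  exists A0 : set T,
    [/\ A A0, P A0 = 1 &
        forall (B : set T) (w : T), A B -> A0 w -> mu w B = 0 \/ mu w B = 1].
Proof.
(* Reindexing from 0; the value [An 0], about which nothing is assumed, is dropped. *)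
pose G n := An n.+1.
have hG n : sub_sigma_field (G n) by exact: hsub.
have Gd n : G n.+1 `<=` G n by exact: hdecr.
have Gcg n : countably_generated (G n) by exact: hcg.
have AE : A = \bigcap_n G n.
  rewrite hA; apply/seteqP; split => X XA n.
    by move=> _; exact: XA.
  by case: n => // n _; exact: XA.
have hA' : sub_sigma_field A by rewrite AE; exact: sub_sigma_field_bigcap.
(* The sets [D s] generate A_1, which contains [A]; independence of [A] from these countably many
   events is all that the zero-one argument takes as input. *)
have [D [GD D0 DI DG]] := countably_generated_pi_system (hG 0%N).1 (Gcg 0%N).
have mD s : measurable (D s) := (hG 0%N).2 _ (GD s).
have hmu' : regular_cond_distr P (\bigcap_n G n) mu by rewrite -AE.
have /choice[N hN] := fun s => rcd_indep hG Gd Gcg hmu' (mD s).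
have [AN PN] : A (\bigcap_s N s) /\ P (\bigcap_s N s) = 1%E.
  apply: sub_sigma_field_bigcap_countable => // s; rewrite ?AE.
    by have [] := hN s.
  by have [] := hN s.
exists (\bigcap_s N s); split => // B w AB Nw.
apply: (@zero_one_of_indep_pi_system _ _ _ _ (range D)) => //.
- by move=> _ [s _ <-].
- by exists [::].
- by rewrite DG; move: AB; rewrite AE; exact.
- move=> _ [s _ <-]; have [_ _ indep] := hN s.
  by apply: indep; [exact: Nw|rewrite -AE].
Qed.
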